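(* Let $p \geq 5$ be prime and let $a \in \mathbb{F}_{p}^{*}$. Then $$\sum_{t=0}^{p-1}a_{p,\,a,\,t}^{2} =p\left(p-1-\left(\frac{-3}{p}\right)-\left(\frac{-3a}{p}\right)\right).$$
   Context: $\mathbb{F}_p$ is the field with $p$ elements, $\mathbb{F}_p^*=\mathbb{F}_p\setminus\{0\}$, and $\left(\frac{\cdot}{p}\right)$ is the Legendre symbol modulo $p$, with $\left(\frac{0}{p}\right)=0$. For $a,b\in\mathbb{F}_p$, let $E_{a,b}$ be the curve $y^2=x^3+ax+b$ over $\mathbb{F}_p$, and define the integer $a_{p,\,a,\,b}$ by $\#E_{a,b}(\mathbb{F}_p)=p+1-a_{p,\,a,\,b}$ (points counted including the one point at infinity); equivalently $a_{p,\,a,\,b}=-\sum_{x\in\mathbb{F}_p}\left(\frac{x^3+ax+b}{p}\right)$. This formula is used for all pairs $(a,b)$, including those with $4a^3+27b^2=0$. A sum over $t=0,\dots,p-1$ is a sum over $t\in\mathbb{F}_p$. *)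

(* Defs.v *)
From mathcomp Require Import all_boot all_order all_algebra.

Set Implicit Arguments.
Unset Strict Implicit.
Unset Printing Implicit Defensive.

Import GRing.Theory.
Local Open Scope ring_scope.

Definition legendre (p : nat) (x : 'F_p) : int :=
  if x == 0 then 0 else if [exists y : 'F_p, y ^+ 2 == x] then 1 else -1.

(* [None] is the point at infinity; no nonsingularity condition is imposed. *)
Definition curve_points (p : nat) (a b : 'F_p) : {set option ('F_p * 'F_p)} :=
  [set P | if P is Some (x, y) then y ^+ 2 == x ^+ 3 + a * x + b else true].

Definition frob_trace (p : nat) (a b : 'F_p) : int :=
  p%:Z + 1 - #|curve_points a b|%:Z.

(* Main.v *)
Require Import Defs.
From mathcomp Require Import all_boot all_order all_algebra.
From mathcomp Require Import ring zify.

(** Write [N t] for the number of affine points of [y ^+ 2 = x ^+ 3 + a * x + t],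
    so that the trace is [p - N t], and the second moment of the trace is
    known once the sums of [N t] and of [N t ^ 2] are.  Every point [(x, y)] of
    the plane lies on exactly one curve of the family, the one with
    [t = y ^+ 2 - f x] where [f x = x ^+ 3 + a * x]; hence the [N t] add up to
    [p ^ 2], and the [N t ^ 2] add up to the number of pairs of points
    [(x, y)], [(x', y')] lying on a common curve, that is, with
    [y ^+ 2 - y' ^+ 2 = f x - f x'] ([sum_sqr_card_fibres]).

    For fixed [x] and [x'] this is a hyperbola in [(y, y')], with [p - 1] points
    when [f x <> f x'] and [2 * p - 1] points when [f x = f x']
    ([card_sqr_diff]).  Thus everything reduces to the number [M] of
    collisions [f x = f x'], and the second moment equals [p * (M - p)].

    Since [f x - f x'] is the product of [x - x'] and
    [x ^+ 2 + x * x' + x' ^+ 2 + a], the collisions form the union of the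
    diagonal and of a conic ([card_cubic_collisions]).  Completing the square
    turns the conic into [u ^+ 2 + 3 * y ^+ 2 = - 4 * a], which has
    [p - legendre (-3)] points ([card_conic]); it meets the diagonal where
    [3 * x ^+ 2 + a = 0], in [1 + legendre (-3 * a)] points.  Therefore
    [M = 2 * p - 1 - legendre (-3) - legendre (-3 * a)]. *)

Import GRing.Theory.
Local Open Scope ring_scope.

(** * Counting pairs and fibres *)

Lemma card_pairs {A B : finType} (P : A -> B -> bool) :
  #|[set w : A * B | P w.1 w.2]| = (\sum_a #|[set b | P a b]|)%N.
Proof.
under eq_bigr => a _ do rewrite -sum1dep_card.
by rewrite pair_big_dep /= sum1dep_card.
Qed.

Lemma card_inj_preim {A : finType} (f : A -> A) (P : pred A) :
  injective f -> #|[set x | P (f x)]| = #|[set x | P x]|.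
Proof.
move=> f_inj; rewrite -(card_preimset [set x | P x] f_inj).
by apply: eq_card => x; rewrite !inE.
Qed.

Lemma sum_card_fibres {A B : finType} (g : A -> B) :
  (\sum_b #|[set x | g x == b]|)%N = #|A|.
Proof.
rewrite -sum1_card (partition_big g xpredT) //=.
by apply: eq_bigr => b _; rewrite -sum1dep_card.
Qed.

(** The square of the size of a fibre counts the pairs inside that fibre, and
    a pair with equal images lies in exactly one fibre. *)
Lemma sum_sqr_card_fibres {A B : finType} (g : A -> B) :
  (\sum_b #|[set x | g x == b]| ^ 2)%N
    = #|[set w : A * A | g w.1 == g w.2]|.
Proof.
rewrite (card_pairs (fun x y => g x == g y)) (partition_big g xpredT) //=.
apply: eq_bigr => b _.
under [RHS]eq_bigr => x /eqP gx.
  rewrite (_ : [set y | g x == g y] = [set y | g y == b]); last first.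
    by apply/setP=> y; rewrite !inE gx eq_sym.
  over.
by rewrite sum_nat_cond_const -mulnn.
Qed.

(** * Hyperbolas and conics over a finite field *)

(** Each nonzero [u] determines [v = c / u]; the value [u = 0] contributes
    nothing unless [c = 0], when [v] is arbitrary. *)
Lemma card_mul_eq {F : finFieldType} (c : F) :
  #|[set w : F * F | w.1 * w.2 == c]| = (#|F|.-1 + (c == 0%R) * #|F|)%N.
Proof.
rewrite (card_pairs (fun u v => u * v == c)) (bigD1 0) //= addnC; congr addn.
  rewrite (eq_bigr (fun _ => 1%N)) => [|u u0].
    by rewrite sum1_card -(cardC1 (0 : F)); apply: eq_card => u; rewrite !inE.
  rewrite -(cards1 (c / u)); apply: eq_card => v; rewrite !inE.
  by rewrite (can2_eq (mulKf u0) (mulVKf u0)) [c / u]mulrC.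
case: (eqVneq c 0) => [->|c0]; rewrite ?mul1n ?mul0n.
  by apply: eq_card => v; rewrite !inE mul0r eqxx.
by apply: eq_card0 => v; rewrite !inE mul0r eq_sym (negbTE c0).
Qed.

(** The change of variables [(y, z) |-> (y - z, y + z)] is invertible because
    [2] is, and turns the equation into [u * v = c]. *)
Lemma card_sqr_diff {F : finFieldType} (c : F) : 2%:R != 0 :> F ->
  #|[set w : F * F | w.1 ^+ 2 - w.2 ^+ 2 == c]|
    = (#|F|.-1 + (c == 0%R) * #|F|)%N.
Proof.
move=> two0; rewrite -card_mul_eq.
rewrite -(card_inj_preim (fun w : F * F => (w.1 - w.2, w.1 + w.2))
                         (fun w => w.1 * w.2 == c)).
  by apply: eq_card => w; rewrite !inE subr_sqr.
move=> [x y] [x' y'] /= [e1 e2]; congr pair; apply: (mulfI two0).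
  have -> : 2%:R * x = (x - y) + (x + y) by ring.
  by rewrite e1 e2; ring.
have -> : 2%:R * y = (x + y) - (x - y) by ring.
by rewrite e1 e2; ring.
Qed.

Lemma card_sqrt_nonzero {F : finFieldType} (s : F) : 2%:R != 0 :> F ->
  s != 0 -> #|[set y : F | y ^+ 2 == s ^+ 2]| = 2%N.
Proof.
move=> two0 s0; rewrite (_ : [set _ | _] = [set s; - s]).
  by rewrite cards2 -addr_eq0 -mulr2n -mulr_natl mulf_neq0.
by apply/setP=> y; rewrite !inE eqf_sqr.
Qed.

Lemma card_sqrt_zero {F : finFieldType} : #|[set y : F | y ^+ 2 == 0]| = 1%N.
Proof.
by rewrite -(cards1 (0 : F)); apply: eq_card => y; rewrite !inE expf_eq0.
Qed.

Lemma card_sqrt_le2 {F : finFieldType} (z : F) : 2%:R != 0 :> F ->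
  (#|[set y : F | y ^+ 2 == z]| <= 2)%N.
Proof.
move=> two0; case: (set_0Vmem [set y : F | y ^+ 2 == z]) => [->|[y]].
  by rewrite cards0.
rewrite inE => /eqP <-; case: (eqVneq y 0) => [->|y0].
  by rewrite expr0n card_sqrt_zero.
by rewrite card_sqrt_nonzero.
Qed.

(** When [d] is not a square, the values of [y ^+ 2] and of [d * y ^+ 2]
    together cover the field exactly twice.  Both kinds of preimage cannot
    occur over the same nonzero [z], as [d] would be a quotient of squares, so
    the sum is at most [2] for each [z]; its total over all [z] is [2 * #|F|],
    which forces equality everywhere. *)
Lemma card_sqrt_twist {F : finFieldType} (d z : F) : 2%:R != 0 :> F ->
  (forall y : F, y ^+ 2 != d) ->
  (#|[set y : F | y ^+ 2 == z]| + #|[set y : F | (d * y ^+ 2)%R == z]|)%N = 2%N.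
Proof.
move=> two0 dN.
have d0 : d != 0 by apply: contraNneq (dN 0) => ->; rewrite expr0n.
pose S (z : F) := #|[set y : F | y ^+ 2 == z]|.
pose S' (z : F) := #|[set y : F | d * y ^+ 2 == z]|.
have S'E t : S' t = S (t / d).
  apply: eq_card => y; rewrite !inE.
  by rewrite (can2_eq (mulKf d0) (mulVKf d0)) [t / d]mulrC.
have le2 t : (S t + S' t <= 2)%N.
  case: (set_0Vmem [set y : F | y ^+ 2 == t]) => [St0|[y]].
    by rewrite {1}/S St0 cards0 S'E card_sqrt_le2.
  rewrite inE => /eqP ty.
  case: (set_0Vmem [set y : F | d * y ^+ 2 == t]) => [St0|[x]].
    by rewrite {1}/S' St0 cards0 addn0 card_sqrt_le2.
  rewrite inE => /eqP tx; case: (eqVneq x 0) => [x0|x0].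
    by rewrite S'E -tx x0 expr0n mulr0 mul0r /S card_sqrt_zero.
  by case/eqP: (dN (y / x)); rewrite expr_div_n ty -tx mulfK ?expf_neq0.
have sumS : (\sum_t (S t + S' t))%N = (\sum_(t : F) 2)%N.
  by rewrite big_split /= /S /S' !sum_card_fibres sum_nat_const addnn muln2.
have /leqif_sum : forall t : F, true -> (S t + S' t <= 2 ?= iff (S t + S' t == 2))%N.
  by move=> t _; split.
by case=> _; rewrite sumS eqxx => /esym /forallP /(_ z) /eqP.
Qed.

(** If [d = s ^+ 2], rescaling the second coordinate by [s] gives the hyperbola
    [u ^+ 2 - y ^+ 2 = c].  If [d] is not a square, the conic and that hyperbola
    have [2 * #|F|] points in all: by [card_sqrt_twist] there are two above each
    [u].  As the hyperbola has [#|F| - 1] points, the conic has [#|F| + 1]. *)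
Lemma card_conic {F : finFieldType} (c d : F) : 2%:R != 0 :> F ->
  c != 0 -> d != 0 ->
  #|[set w : F * F | w.1 ^+ 2 - d * w.2 ^+ 2 == c]|
    = if [exists s, s ^+ 2 == d] then #|F|.-1 else #|F|.+1.
Proof.
move=> two0 c0 d0; have := card_sqr_diff c two0.
rewrite (negbTE c0) addn0 => cardH.
case: ifPn => [/existsP [s /eqP ds]|/existsPn dN].
  have s0 : s != 0 by apply: contraNneq d0 => s0; rewrite -ds s0 expr0n.
  rewrite -cardH -(card_inj_preim (fun w : F * F => (w.1, s * w.2))
                                  (fun w => w.1 ^+ 2 - w.2 ^+ 2 == c)).
    by apply: eq_card => w; rewrite !inE /= exprMn ds.
  by move=> [x y] [x' y'] /= [-> /(mulfI s0) ->].
suff: (#|F|.-1 + #|[set w : F * F | (w.1 ^+ 2 - d * w.2 ^+ 2)%R == c]|)%N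
       = (2 * #|F|)%N.
  have : (0 < #|F|)%N by apply/card_gt0P; exists 0.
  by lia.
rewrite -cardH (card_pairs (fun u y => u ^+ 2 - y ^+ 2 == c)).
rewrite (card_pairs (fun u y => u ^+ 2 - d * y ^+ 2 == c)) -big_split /=.
have <- : (\sum_(u : F) 2)%N = (2 * #|F|)%N by rewrite sum_nat_const [LHS]mulnC.
apply: eq_bigr => u _; have twist := card_sqrt_twist d (u ^+ 2 - c) two0 dN.
have subC (v : F) : (u ^+ 2 - v == c) = (v == u ^+ 2 - c).
  by rewrite subr_eq [RHS]eq_sym subr_eq addrC.
by apply: etrans twist; congr addn; apply: eq_card => y; rewrite !inE subC.
Qed.

(** * The curves [y ^+ 2 = x ^+ 3 + a * x + t] *)

(** The collisions are the union of the diagonal [D] and of the conic [Q]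
    obtained by dividing out [x - y].  The square roots of [-3 * a] stand for
    [D :&: Q], so that the claim is inclusion-exclusion, free of truncated
    subtraction. *)
Lemma card_cubic_collisions {F : finFieldType} (a : F) :
  2%:R != 0 :> F -> 3%:R != 0 :> F -> a != 0 ->
  (#|[set w : F * F | (w.1 ^+ 3 + a * w.1 == w.2 ^+ 3 + a * w.2)%R]|
     + #|[set y : F | (y ^+ 2 == -3 * a)%R]|)%N
  = (#|F| + if [exists s : F, (s ^+ 2 == -3)%R] then #|F|.-1 else #|F|.+1)%N.
Proof.
move=> two0 three0 a0.
pose D := [set w : F * F | w.1 == w.2].
pose Q := [set w : F * F | w.1 ^+ 2 + w.1 * w.2 + w.2 ^+ 2 + a == 0].
have -> : [set w : F * F | w.1 ^+ 3 + a * w.1 == w.2 ^+ 3 + a * w.2] = D :|: Q.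
  apply/setP=> -[x y]; rewrite !inE /= -subr_eq0 -[x == y]subr_eq0 -mulf_eq0.
  by congr (_ == 0); ring.
have cardD : #|D| = #|F|.
  rewrite (card_pairs (fun x y : F => x == y)) -sum1_card.
  apply: eq_bigr => x _; rewrite -(cards1 x).
  by apply: eq_card => y; rewrite !inE eq_sym.
have cardDQ : #|D :&: Q| = #|[set y : F | y ^+ 2 == -3 * a]|.
  (* (3x)^2 = -3a is three times the equation 3x^2 + a = 0 of Q on D. *)
  rewrite -(card_inj_preim (fun y => 3%:R * y) (fun y : F => y ^+ 2 == -3 * a));
    last exact: mulfI.
  have dI : injective (fun x : F => (x, x)) by move=> x y [].
  rewrite -(card_imset _ dI); apply: eq_card => -[x y]; rewrite !inE /=.
  have E : ((3%:R * x) ^+ 2 == -3 * a) = (x ^+ 2 + x * x + x ^+ 2 + a == 0).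
    rewrite -subr_eq0.
    rewrite (_ : _ - _ = 3%:R * (x ^+ 2 + x * x + x ^+ 2 + a)); last by ring.
    by rewrite mulf_eq0 (negbTE three0).
  apply/andP/imsetP => [[/eqP <- h]|[z]].
    by exists x; rewrite // inE E.
  by rewrite inE => + [xz ->]; rewrite -xz E eqxx.
have cardQ : #|Q| = if [exists s : F, s ^+ 2 == -3] then #|F|.-1 else #|F|.+1.
  have four0 : 4%:R != 0 :> F by rewrite (natrM F 2 2) mulf_neq0.
  (* 4 (x^2 + xy + y^2) = (2x + y)^2 + 3 y^2 *)
  rewrite -(card_conic (- (4%:R * a))) ?oppr_eq0 ?mulf_neq0 //.
  rewrite -(card_inj_preim (fun w : F * F => (2%:R * w.1 + w.2, w.2))
      (fun w => w.1 ^+ 2 - -3 * w.2 ^+ 2 == - (4%:R * a))).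
    apply: eq_card => -[x y]; rewrite !inE /= -[RHS]subr_eq0.
    rewrite (_ : _ - - (4%:R * a)
               = 4%:R * (x ^+ 2 + x * y + y ^+ 2 + a)); last by ring.
    by rewrite mulf_eq0 (negbTE four0).
  move=> [x y] [x' y'] /= [e yy']; rewrite yy' in e *.
  by rewrite (mulfI two0 (addIr _ e)).
by rewrite -cardDQ -cardQ -cardD cardsUI.
Qed.

(** Regrouping two points as a pair [(x, x')] of abscissae and a pair [(y, y')]
    of ordinates leaves, for each [(x, x')], the hyperbola of [card_sqr_diff]
    with constant [f x - f x'], which has [#|F|] extra points at a collision. *)
Lemma card_curve_pairs {F : finFieldType} (f : F -> F) : 2%:R != 0 :> F ->
  #|[set v : (F * F) * (F * F) |
       v.1.2 ^+ 2 - f v.1.1 == v.2.2 ^+ 2 - f v.2.1]|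
  = (#|F| ^ 2 * #|F|.-1 + #|[set w : F * F | f w.1 == f w.2]| * #|F|)%N.
Proof.
move=> two0.
pose P (u w : F * F) := w.1 ^+ 2 - w.2 ^+ 2 == f u.1 - f u.2.
rewrite (_ : #|_| = #|[set v : (F * F) * (F * F) | P v.1 v.2]|).
  rewrite card_pairs; under eq_bigr => u _ do rewrite card_sqr_diff //.
  rewrite big_split /= sum_nat_const card_prod mulnn -big_distrl /=.
  congr (_ + _ * _)%N; rewrite -sum1dep_card [RHS]big_mkcond /=.
  by apply: eq_bigr => u _; rewrite subr_eq0; case: eqP.
pose h (v : (F * F) * (F * F)) := ((v.1.1, v.2.1), (v.1.2, v.2.2)).
rewrite -(card_inj_preim h (fun v => P v.1 v.2)).
  apply: eq_card => -[[x y] [x' y']]; rewrite !inE /P /= -subr_eq0.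
  by rewrite -[RHS]subr_eq0; congr (_ == 0); ring.
by move=> [[x y] [x' y']] [[z t] [z' t']] [-> -> -> ->].
Qed.

Lemma card_sqrt_legendre {p : nat} (z : 'F_p) : 2%:R != 0 :> 'F_p ->
  #|[set y : 'F_p | y ^+ 2 == z]|%:Z = 1 + legendre z.
Proof.
move=> two0; rewrite /legendre; case: (eqVneq z 0) => [->|z0].
  by rewrite card_sqrt_zero.
case: ifPn => [/existsP [s /eqP sz]|/existsPn zN].
  rewrite -sz card_sqrt_nonzero //.
  by apply: contraNneq z0 => s0; rewrite -sz s0 expr0n.
by rewrite eq_card0 // => y; rewrite inE (negbTE (zN y)).
Qed.

Lemma frob_traceE {p : nat} (a t : 'F_p) :
  frob_trace a t = p%:Z - #|[set w : 'F_p * 'F_p |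
                               w.2 ^+ 2 - (w.1 ^+ 3 + a * w.1) == t]|%:Z.
Proof.
rewrite /frob_trace; set A := [set w : 'F_p * 'F_p | _ == t].
suff -> : #|curve_points a t| = #|A|.+1 by lia.
have -> : curve_points a t = None |: Some @: A.
  apply/setP=> -[[x y]|]; rewrite !inE //= mem_imset; last by move=> ? ? [].
  by rewrite inE /= subr_eq addrC.
rewrite cardsU1 card_imset; last by move=> ? ? [].
rewrite (_ : None \in _ = false) //.
by apply/imsetP=> -[].
Qed.

Theorem theorem5 (p : nat) (p_prime : prime p) (p_ge5 : (5 <= p)%N)
    (a : 'F_p) (a_neq0 : a != 0) :
  \sum_(t : 'F_p) (frob_trace a t) ^+ 2 =
    p%:Z * (p%:Z - 1 - legendre (-3 : 'F_p) - legendre (-3 * a : 'F_p)).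
Proof.
have natF_neq0 n : (0 < n < p)%N -> n%:R != 0 :> 'F_p.
  move=> /andP [n0 np]; rewrite -(dvdn_pcharf (pchar_Fp p_prime)).
  by rewrite gtnNdvd.
have two0 : 2%:R != 0 :> 'F_p by apply: natF_neq0; lia.
have three0 : 3%:R != 0 :> 'F_p by apply: natF_neq0; lia.
have cardF : #|'F_p| = p by rewrite card_Fp.
pose g (w : 'F_p * 'F_p) := w.2 ^+ 2 - (w.1 ^+ 3 + a * w.1).
pose N t := #|[set w | g w == t]|.
pose M := #|[set w : 'F_p * 'F_p |
              w.1 ^+ 3 + a * w.1 == w.2 ^+ 3 + a * w.2]|.
have sumN : (\sum_t N t)%N = (p ^ 2)%N.
  by rewrite sum_card_fibres card_prod cardF mulnn.
have sumN2 : (\sum_t N t ^ 2)%N = (p ^ 2 * p.-1 + M * p)%N.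
  rewrite sum_sqr_card_fibres.
  by rewrite (card_curve_pairs (fun x => x ^+ 3 + a * x)) // cardF.
have M_E : M%:Z = 2%:Z * p%:Z - 1 - legendre (-3 : 'F_p) - legendre (-3 * a).
  have := @card_cubic_collisions _ a two0 three0 a_neq0.
  rewrite -/M cardF => /(congr1 Posz); rewrite PoszD card_sqrt_legendre //.
  rewrite {2}/legendre oppr_eq0 (negbTE three0).
  by case: ifP => _; move: (legendre _) (M) => l m; lia.
have -> : \sum_t frob_trace a t ^+ 2
        = p%:Z ^+ 3 - 2%:Z * p%:Z * (\sum_t N t)%N%:Z + (\sum_t N t ^ 2)%N%:Z.
  rewrite !(big_morph Posz PoszD (erefl _)).
  rewrite (eq_bigr (fun t => p%:Z ^+ 2 + (- (2%:Z * p%:Z) * (N t)%:Z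
                             + (N t ^ 2)%N%:Z))); last first.
    by move=> t _; rewrite frob_traceE -/g -/(N t) -mulnn PoszM; ring.
  rewrite !big_split /= sumr_const cardF -mulr_sumr -mulr_natr natz; ring.
rewrite sumN sumN2 PoszD !PoszM M_E (_ : p.-1%:Z = p%:Z - 1); last by lia.
by ring.
Qed.
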